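(* Suppose $(U,S)$ is an action pair in a monoid $M$, with $U$ and $S$ submonoids of $M$. Let $\Phi:(X_U\cup X_S)^*\to US$ be the morphism determined by $x\mapsto x\phi_U$ for $x\in X_U$ and $x\mapsto x\phi_S$ for $x\in X_S$. (i) If there exists a subset $V\subseteq U$ such that $$\theta_u=\bigvee_{v\in V,\ v\preceq u}\theta_v\qquad\text{for all }u\in U,$$ then $US$ has presentation $\operatorname{Mon}\langle X_U\cup X_S:R_U\cup R_S\cup R_1\cup R_2'\cup R_3\rangle$ via $\Phi$, where $$R_2'=\{(N_U(v)N_S(s),\,N_U(v)N_S(t)):v\in V,\ (s,t)\in\Omega_v\}.$$ (ii) If $U$ is commutative, and if $\theta_{uv}=\theta_u\vee\theta_v$ for all $u,v\in U$, then $US$ has presentation $\operatorname{Mon}\langle X_U\cup X_S:R_U\cup R_S\cup R_1\cup R_2''\cup R_3\rangle$ via $\Phi$, where $$R_2''=\{(xN_S(s),\,xN_S(t)):x\in X_U,\ (s,t)\in\Omega_{\overline x}\}.$$ Here $$R_1=\{(xy,\,{}^xy\cdot x):x\in X_S,\ y\in X_U\},\qquad R_3=\{(x,\,x^+x):x\in X_S,\ \overline x^+\neq1\},$$ with ${}^xy=N_U({}^{\overline x}\,\overline y)\in X_U^*$ and $x^+=N_U(\overline x^+)\in X_U^*$ for $x\in X_S$, $y\in X_U$.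
   Context: Action pairs. For a monoid $M$ with identity $1$ and a subsemigroup $U$, $U^1=U\cup\{1\}$. An action pair in $M$ is a pair $(U,S)$ of subsemigroups of $M$ with a left action $(s,u)\mapsto{}^su$ of $S$ on $U^1$ by semigroup morphisms (${}^s({}^tu)={}^{st}u$ and ${}^s(uv)={}^su\cdot{}^sv$) such that (A1) $s\cdot u={}^su\cdot s$ for all $s\in S$, $u\in U^1$, and (A2) $us=vt\Rightarrow u\cdot{}^s1=v\cdot{}^t1$ for all $u,v\in U^1$, $s,t\in S$. Write $s^+={}^s1$ for $s\in S$. $US=\{us:u\in U,s\in S\}$. For $u\in U$ let $\theta_u=\{(s,t)\in S\times S:us=ut\}$, a right congruence on $S$, and let $\Omega_u\subseteq S\times S$ be a fixed set of pairs generating $\theta_u$ as a right congruence. For $u,v\in U$, $v\preceq u$ means $u=wv$ for some $w\in U^1$. Joins are taken in the lattice of all equivalence relations on $S$ (so an empty join is the equality relation). Presentations. $X^*$ is the free monoid on $X$, with empty word $\iota$; for $R\subseteq X^*\times X^*$, $R^\sharp$ is the congruence generated by $R$. A monoid $T$ has presentation $\operatorname{Mon}\langle X:R\rangle$ via $\phi$ if $\phi:X^*\to T$ is a surjective monoid morphism with kernel $R^\sharp$. A normal form function is a map $N:T\to X^*$ with $N(t)\phi=t$ for all $t\in T$. Maps are written on the right. Fixed data. $U$ has presentation $\operatorname{Mon}\langle X_U:R_U\rangle$ via $\phi_U:X_U^*\to U$, and $S$ has presentation $\operatorname{Mon}\langle X_S:R_S\rangle$ via $\phi_S:X_S^*\to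 S$, where $X_U\cap X_S=\varnothing$, no letter of $X_U$ or $X_S$ maps to $1$, and $\phi_U|_{X_U}$, $\phi_S|_{X_S}$ are injective. Write $\overline w=w\phi_U$ for $w\in X_U^*$ and $\overline w=w\phi_S$ for $w\in X_S^*$. $N_U:U\to X_U^*$ and $N_S:S\to X_S^*$ are fixed normal form functions with $N_U(1)=N_S(1)=\iota$, $N_U(\overline x)=x$ for $x\in X_U$, and $N_S(\overline y)=y$ for $y\in X_S$. *)

(* Defs.v *)
From HB Require Import structures.
From mathcomp Require Import all_boot.
From mathcomp Require Import boolp classical_sets.

Set Implicit Arguments.
Unset Strict Implicit.
Unset Printing Implicit Defensive.

Import Algebra.

Local Open Scope classical_set_scope.
Local Open Scope group_scope.

(* A binary relation on T is a [set (T * T)].  Substructures of a monoid M are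
   sets of elements of M, and operations attached to them (the action, normal
   form functions, generating sets of relations) are total on M; only their
   values on the relevant substructures are ever constrained or used. *)

Section Relations.
Context {T : Type}.
Implicit Types (A : set T) (E : set (T * T)).

Definition equivalence_on A E : Prop :=
  [/\ E `<=` A `*` A,
      forall x, A x -> E (x, x),
      forall x y, E (x, y) -> E (y, x)
    & forall x y z, E (x, y) -> E (y, z) -> E (x, z)].

(* Join in the lattice of equivalence relations on A; over an empty index set
   this is the equality relation on A. *)
Definition equiv_join A {I : Type} (D : set I) (F : I -> set (T * T)) :
    set (T * T) :=
  smallest (equivalence_on A) (\bigcup_(i in D) F i).

End Relations.

Section Submonoids.
Context {M : monoidType}.
Implicit Types (A U S V : set M) (E : set (M * M)).

Definition subsemigroup A : Prop := forall x y, A x -> A y -> A (x * y).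

Definition submonoid A : Prop := A 1 /\ subsemigroup A.

Definition adjoin1 A : set M := A `|` [set 1].

Definition setprod A B : set M := [set a * b | a in A & b in B].

Definition right_congruence_on A E : Prop :=
  equivalence_on A E /\
  forall s t r, E (s, t) -> A r -> E (s * r, t * r).

(* [act s u] is the action of s on u. *)
Record action_pair U S (act : M -> M -> M) : Prop := ActionPair {
  action_pair_subl : subsemigroup U;
  action_pair_subr : subsemigroup S;
  action_pair_act : forall s u, S s -> adjoin1 U u -> adjoin1 U (act s u);
  action_pair_actM : forall s t u, S s -> S t -> adjoin1 U u ->
    act s (act t u) = act (s * t) u;
  action_pair_morph : forall s u v, S s -> adjoin1 U u -> adjoin1 U v ->
    act s (u * v) = act s u * act s v;
  action_pair_A1 : forall s u, S s -> adjoin1 U u -> s * u = act s u * s;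
  action_pair_A2 : forall u v s t, adjoin1 U u -> adjoin1 U v -> S s -> S t ->
    u * s = v * t -> u * act s 1 = v * act t 1
}.

Definition theta S (u : M) : set (M * M) :=
  [set st | [/\ S st.1, S st.2 & u * st.1 = u * st.2]].

Definition generates_right_congruence S (Om E : set (M * M)) : Prop :=
  Om `<=` S `*` S /\ smallest (right_congruence_on S) Om = E.

Definition preceq U (v u : M) : Prop := exists2 w, adjoin1 U w & u = w * v.

End Submonoids.

(* The free monoid X^* is [seq X], with concatenation. *)
Section Presentations.
Context {M : monoidType} {X : Type}.
Implicit Types (T : set M) (phi : seq X -> M) (R : set (seq X * seq X)).

Definition word_congruence R : Prop :=
  equivalence_on setT R /\
  forall a b p q, R (a, b) -> R (p ++ a ++ q, p ++ b ++ q).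

Definition congruence_generated R : set (seq X * seq X) :=
  smallest word_congruence R.

Definition word_morphism phi : Prop :=
  phi [::] = 1 /\ forall a b, phi (a ++ b) = phi a * phi b.

Definition word_kernel phi : set (seq X * seq X) :=
  [set ab | phi ab.1 = phi ab.2].

(* The submonoid T of M has presentation Mon<X : R> via phi. *)
Definition has_presentation T R phi : Prop :=
  [/\ word_morphism phi,
      range phi = T
    & word_kernel phi = congruence_generated R].

Definition normal_form_function T phi (N : M -> seq X) : Prop :=
  forall t, T t -> phi (N t) = t.

End Presentations.

(* The union of the disjoint alphabets XU and XS is the sum type XU + XS. *)
Section Relators.
Context {M : monoidType} {XU XS : Type}.
Variables (phiU : seq XU -> M) (phiS : seq XS -> M).
Variables (act : M -> M -> M) (Om : M -> set (M * M)).
Variables (NU : M -> seq XU) (NS : M -> seq XS).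

Local Notation word := (seq (XU + XS)).

Definition wordU (w : seq XU) : word := map inl w.
Definition wordS (w : seq XS) : word := map inr w.

Definition Phi (w : word) : M :=
  \prod_(z <- w) match z with inl x => phiU [:: x] | inr x => phiS [:: x] end.

Definition liftU (R : set (seq XU * seq XU)) : set (word * word) :=
  [set (wordU r.1, wordU r.2) | r in R].

Definition liftS (R : set (seq XS * seq XS)) : set (word * word) :=
  [set (wordS r.1, wordS r.2) | r in R].

Definition R1 : set (word * word) :=
  [set r | exists (x : XS) (y : XU),
     r = (wordS [:: x] ++ wordU [:: y],
          wordU (NU (act (phiS [:: x]) (phiU [:: y]))) ++ wordS [:: x])].

Definition R2' (V : set M) : set (word * word) :=
  [set r | exists v s t, [/\ V v, Om v (s, t)
    & r = (wordU (NU v) ++ wordS (NS s), wordU (NU v) ++ wordS (NS t))]].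

Definition R2'' : set (word * word) :=
  [set r | exists (x : XU) s t, Om (phiU [:: x]) (s, t) /\
     r = (wordU [:: x] ++ wordS (NS s), wordU [:: x] ++ wordS (NS t))].

Definition R3 : set (word * word) :=
  [set r | exists x : XS, act (phiS [:: x]) 1 <> 1 /\
     r = (wordS [:: x], wordU (NU (act (phiS [:: x]) 1)) ++ wordS [:: x])].

End Relators.

(* Main.v *)
Require Import Defs.
From HB Require Import structures.
From mathcomp Require Import all_boot.
From mathcomp Require Import boolp classical_sets.

(** Write [a ~ b] for the congruence generated by the proposed relators.

    The relators in R1 push letters of [S] to the right past letters of [U],
    so every word is [~]-equivalent to a factored word, one over [XU] followed
    by one over [XS] ([cong_factor]).  The relators in R3 are R1 for the empty
    word in place of a letter of [U]: they insert [s^+] in front of [s], so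
    that a factored word for [u * s] is equivalent to one for
    [(u * s^+) * s] ([cong_absorb]).

    Let two factored words have equal values, [u * s = v * t].  By (A2) the
    elements [u * s^+] and [v * t^+] coincide; call them [w].  Then
    [w * s = u * s = v * t = w * t], that is, [(s, t)] lies in [theta S w].
    Hence the whole question is whether, for each [w] in [U], all pairs of
    [theta S w] are derivable to the right of a word for [w]
    ([presentation_of_derivable_theta]).

    For fixed [w] the derivable pairs form a right congruence on [S], which only
    grows when [w] is multiplied on the left ([derivable_theta_mull]).  It
    contains [theta S v] as soon as it contains a generating set of it.  In
    part (i) the relators provide this for [v] in [V], and every [theta S w] is
    a join of such congruences with [w] a left multiple of [v].  In part (ii)
    the relators provide it for the letters, and one goes through a word for
    [w] letter by letter; commutativity makes [w] a left multiple of each of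
    them. *)

Import Algebra.

Local Open Scope classical_set_scope.
Local Open Scope group_scope.

(** * Congruences on free monoids *)

Section Congruences.
Context {X : Type}.
Implicit Types (R : set (seq X * seq X)) (a b c d : seq X).

Lemma word_congruence_generated R : word_congruence (congruence_generated R).
Proof.
split; first split.
- by move=> ? _.
- by move=> a _ E [[[_ r _ _] _] _]; apply: r.
- move=> a b ab E EE; have [[[_ _ s _] _] _] := EE.
  exact: s (ab _ EE).
- move=> a b c ab bc E EE; have [[[_ _ _ t] _] _] := EE.
  exact: t (ab _ EE) (bc _ EE).
move=> a b p q ab E EE; have [[_ ctx] _] := EE.
exact: ctx (ab _ EE).
Qed.

Lemma cong_refl R a : congruence_generated R (a, a).
Proof. by have [[_ r _ _] _] := word_congruence_generated R; apply: r. Qed.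

Lemma cong_sym {R a b} :
  congruence_generated R (a, b) -> congruence_generated R (b, a).
Proof. by have [[_ _ s _] _] := word_congruence_generated R; apply: s. Qed.

Lemma cong_trans {R a} b {c} :
  congruence_generated R (a, b) -> congruence_generated R (b, c) ->
  congruence_generated R (a, c).
Proof. by have [[_ _ _ t] _] := word_congruence_generated R; apply: t. Qed.

Lemma cong_cat {R a b c d} :
  congruence_generated R (a, b) -> congruence_generated R (c, d) ->
  congruence_generated R (a ++ c, b ++ d).
Proof.
have [_ ctx] := word_congruence_generated R.
move=> /(ctx _ _ [::] c) /= ab /(ctx _ _ b [::]); rewrite !cats0.
exact: cong_trans.
Qed.

Lemma cong_catl {R} a {c d} :
  congruence_generated R (c, d) -> congruence_generated R (a ++ c, a ++ d).
Proof. exact: cong_cat (cong_refl _ _). Qed.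

Lemma cong_catr {R} c {a b} :
  congruence_generated R (a, b) -> congruence_generated R (a ++ c, b ++ c).
Proof. by move=> ab; apply: cong_cat ab (cong_refl _ _). Qed.

Lemma cong_relator {R a b} : R (a, b) -> congruence_generated R (a, b).
Proof. by move=> ab E [_]; apply. Qed.

Lemma word_kernelI {M : monoidType} {phi : seq X -> M} a b :
  phi a = phi b -> word_kernel phi (a, b).
Proof. by []. Qed.

Lemma word_congruence_kernel {M : monoidType} {phi : seq X -> M} :
  word_morphism phi -> word_congruence (word_kernel phi).
Proof.
move=> [_ phiM]; split; first split => //.
  by move=> a b c; rewrite /word_kernel /= => -> ->.
by move=> a b p q; rewrite /word_kernel /= !phiM => ->.
Qed.

(** The pairs whose images under a free-monoid morphism [f] are congruent form
    a congruence, so it suffices to look at the relators. *)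
Lemma cong_map {Y : Type} {f : seq Y -> seq X} {RY : set (seq Y * seq Y)} {R} :
  {morph f : x y / x ++ y} ->
  (forall x y, RY (x, y) -> R (f x, f y)) ->
  forall x y, congruence_generated RY (x, y) ->
    congruence_generated R (f x, f y).
Proof.
move=> fM RYR x y xy.
apply: (xy [set ab | congruence_generated R (f ab.1, f ab.2)]); split.
  split; first split => //=.
  - by move=> z _; apply: cong_refl.
  - by move=> u v; apply: cong_sym.
  - by move=> u v w; apply: cong_trans.
  move=> c d p q /= cd; rewrite !fM.
  exact: cong_catl (cong_catr _ cd).
by move=> [c d] /RYR /cong_relator.
Qed.

End Congruences.

(** * Action pairs and factored words *)

Section ActionPairs.
Context {M : monoidType} {U S : set M} {act : M -> M -> M}.
Hypotheses (hUS : action_pair U S act) (hU : submonoid U) (hS : submonoid S).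
Context {XU XS : Type}.
Context {RU : set (seq XU * seq XU)} {RS : set (seq XS * seq XS)}.
Context {phiU : seq XU -> M} {phiS : seq XS -> M}.
Hypotheses (hphiU : has_presentation U RU phiU).
Hypotheses (hphiS : has_presentation S RS phiS).
Context {NU : M -> seq XU} {NS : M -> seq XS}.
Hypotheses (hNU : normal_form_function U phiU NU).
Hypotheses (hNS : normal_form_function S phiS NS).
Hypothesis (hNU1 : NU 1 = [::]).

Local Notation Phi := (Phi phiU phiS).
Local Notation word := (seq (XU + XS)).

Lemma phiU_in a : U (phiU a).
Proof. by have [_ <- _] := hphiU; exists a. Qed.

Lemma phiS_in b : S (phiS b).
Proof. by have [_ <- _] := hphiS; exists b. Qed.

Lemma phiU_cat a b : phiU (a ++ b) = phiU a * phiU b.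
Proof. by have [[_ ->]] := hphiU. Qed.

Lemma phiS_cat a b : phiS (a ++ b) = phiS a * phiS b.
Proof. by have [[_ ->]] := hphiS. Qed.

Lemma phiU_nil : phiU [::] = 1.
Proof. by have [[->]] := hphiU. Qed.

Lemma phiS_nil : phiS [::] = 1.
Proof. by have [[->]] := hphiS. Qed.

Lemma wordU_cat a b : wordU (a ++ b) = wordU a ++ wordU b :> word.
Proof. exact: map_cat. Qed.

Lemma wordS_cat a b : wordS (a ++ b) = wordS a ++ wordS b :> word.
Proof. exact: map_cat. Qed.

Lemma adjoin1_sub u : adjoin1 U u <-> U u.
Proof. by split=> [[//|->]|]; [case: hU|left]. Qed.

Lemma act_in s u : S s -> U u -> U (act s u).
Proof.
by move=> Ss Uu; apply/adjoin1_sub/(action_pair_act hUS) => //; apply/adjoin1_sub.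
Qed.

Lemma plus_in s : S s -> U (act s 1).
Proof. by move=> Ss; apply: act_in => //; case: hU. Qed.

Lemma mul_act s u : S s -> U u -> s * u = act s u * s.
Proof. by move=> Ss Uu; apply: (action_pair_A1 hUS) => //; apply/adjoin1_sub. Qed.

Lemma act1 u : U u -> act 1 u = u.
Proof.
by move=> Uu; have := @mul_act 1 u hS.1 Uu; rewrite mul1g mulg1.
Qed.

Lemma plusK s : S s -> act s 1 * s = s.
Proof. by move=> Ss; rewrite -mul_act ?mulg1//; case: hU. Qed.

Lemma Phi_morphism : word_morphism Phi.
Proof.
by split=> [|a b]; rewrite /Defs.Phi ?big_nil ?big_cat.
Qed.

Lemma Phi_wordU a : Phi (wordU a) = phiU a.
Proof.
rewrite /Defs.Phi big_map; elim: a => [|x a IH]; first by rewrite big_nil phiU_nil.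
by rewrite big_cons IH -phiU_cat.
Qed.

Lemma Phi_wordS b : Phi (wordS b) = phiS b.
Proof.
rewrite /Defs.Phi big_map; elim: b => [|y b IH]; first by rewrite big_nil phiS_nil.
by rewrite big_cons IH -phiS_cat.
Qed.

Lemma Phi_factored a b : Phi (wordU a ++ wordS b) = phiU a * phiS b.
Proof. by rewrite Phi_morphism.2 Phi_wordU Phi_wordS. Qed.

Definition common_relators : set (word * word) :=
  liftU RU `|` liftS RS `|` R1 phiU phiS act NU `|` R3 phiS act NU.

Lemma common_relators_sound : common_relators `<=` word_kernel Phi.
Proof.
have [_ _ kU] := hphiU; have [_ _ kS] := hphiS.
move=> r [[[|]|]|].
- move=> [ab ab_rel <-]; suff: word_kernel phiU ab.
    by rewrite /word_kernel /= !Phi_wordU.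
  by rewrite kU; apply: sub_gen_smallest.
- move=> [ab ab_rel <-]; suff: word_kernel phiS ab.
    by rewrite /word_kernel /= !Phi_wordS.
  by rewrite kS; apply: sub_gen_smallest.
- move=> [x [y ->]]; have Sx := phiS_in [:: x]; have Uy := phiU_in [:: y].
  apply: word_kernelI; rewrite [LHS]Phi_morphism.2 [RHS]Phi_factored Phi_wordS Phi_wordU.
  by rewrite hNU 1?mul_act//; apply: act_in.
- move=> [x [_ ->]]; have Sx := phiS_in [:: x].
  apply: word_kernelI; rewrite [LHS]Phi_wordS [RHS]Phi_factored hNU ?plusK//.
  exact: plus_in.
Qed.

Section Derivations.
Context {R : set (word * word)}.
Hypothesis (coreR : common_relators `<=` R).

Local Notation "a ~ b" := (congruence_generated R (a, b)) (at level 70).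

Lemma cong_wordU a b : phiU a = phiU b -> wordU a ~ wordU b.
Proof.
have [_ _ kU] := hphiU => ab.
have: word_kernel phiU (a, b) by [].
rewrite kU; apply: cong_map => [? ?|c d cd]; first exact: wordU_cat.
by apply: coreR; left; left; left; exists (c, d).
Qed.

Lemma cong_wordS a b : phiS a = phiS b -> wordS a ~ wordS b.
Proof.
have [_ _ kS] := hphiS => ab.
have: word_kernel phiS (a, b) by [].
rewrite kS; apply: cong_map => [? ?|c d cd]; first exact: wordS_cat.
by apply: coreR; left; left; right; exists (c, d).
Qed.

(** The base case is where R3 enters: for the empty word, moving [x] to the
    right still leaves the prefix [x^+] behind. *)
Lemma cong_letter_past x a :
  wordS [:: x] ++ wordU a ~
    wordU (NU (act (phiS [:: x]) (phiU a))) ++ wordS [:: x].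
Proof.
have Sx := phiS_in [:: x].
elim: a => [|y a IH].
  rewrite phiU_nil cats0.
  have [->|x1] := EM (act (phiS [:: x]) 1 = 1).
    by rewrite hNU1; apply: cong_refl.
  by apply: cong_relator; apply: coreR; right; exists x.
apply: (@cong_trans _ _ _
  (wordU (NU (act (phiS [:: x]) (phiU [:: y]))) ++ wordS [:: x] ++ wordU a)).
  rewrite -(cat1s y) wordU_cat !catA; apply: cong_catr; apply: cong_relator; apply: coreR.
  by left; right; exists x, y.
apply: (cong_trans _ (cong_catl _ IH)).
rewrite catA -wordU_cat; apply: cong_catr; apply: cong_wordU.
have Uy := phiU_in [:: y]; have Ua := phiU_in a.
rewrite phiU_cat !hNU; do ?exact: act_in; last exact/act_in/phiU_in.
rewrite -(action_pair_morph hUS) -?phiU_cat//; exact/adjoin1_sub/phiU_in.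
Qed.

Lemma cong_word_past b a :
  wordS b ++ wordU a ~ wordU (NU (act (phiS b) (phiU a))) ++ wordS b.
Proof.
elim: b a => [|x b IH] a.
  rewrite cats0 phiS_nil act1; last exact: phiU_in.
  by apply: cong_wordU; rewrite hNU//; apply: phiU_in.
have Uba : U (act (phiS b) (phiU a)) by apply: act_in (phiS_in _) (phiU_in _).
rewrite -(cat1s x) wordS_cat -catA.
apply: (cong_trans _ (cong_catl _ (IH a))); rewrite !catA; apply: cong_catr.
apply: (cong_trans _ (cong_letter_past _ _)).
rewrite hNU // (action_pair_actM hUS) -?phiS_cat; last exact/adjoin1_sub/phiU_in.
- exact: cong_refl.
- exact: phiS_in.
- exact: phiS_in.
Qed.

Lemma cong_factor w : exists a b, w ~ wordU a ++ wordS b.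
Proof.
elim: w => [|[x|x] w [a [b IH]]].
- by exists [::], [::]; apply: cong_refl.
- by exists (x :: a), b; apply: cong_catl [:: inl x] _ _ IH.
exists (NU (act (phiS [:: x]) (phiU a))), (x :: b).
apply: (cong_trans _ (cong_catl [:: inr x] IH)).
rewrite (catA [:: _]) -(cat1s x b) wordS_cat catA.
exact: cong_catr (cong_letter_past _ _).
Qed.

(** Moving [b] to the right past the empty word leaves [b^+] behind.  The new
    [U]-part [u * s^+] is what (A2) makes an invariant of the product
    [u * s]. *)
Lemma cong_absorb a b :
  wordU a ++ wordS b ~
    wordU (NU (phiU a * act (phiS b) 1)) ++ wordS b.
Proof.
have Ub : U (act (phiS b) 1) by apply/plus_in/phiS_in.
have := cong_word_past b [::]; rewrite cats0 phiU_nil => /(cong_catl (wordU a)).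
move=> /cong_trans; apply; rewrite catA -wordU_cat; apply: cong_catr; apply: cong_wordU.
by rewrite phiU_cat !hNU//; apply: hU.2 => //; apply: phiU_in.
Qed.

(** The part of [theta S u] that is visible from the relators alone; soundness
    of [R] makes it a subset of [theta S u], and the presentation holds when
    nothing is lost. *)
Definition derivable_theta u : set (M * M) :=
  [set st | [/\ S st.1, S st.2 &
    wordU (NU u) ++ wordS (NS st.1) ~ wordU (NU u) ++ wordS (NS st.2)]].

(** Compatibility with right multiplication is plain: [NS (s * r)] may be
    exchanged for [NS s ++ NS r] by the relators of [S]. *)
Lemma derivable_theta_right_congruence u :
  right_congruence_on S (derivable_theta u).
Proof.
split; first split.
- by move=> [s t] [].
- by move=> s Ss; split=> //; apply: cong_refl.
- by move=> s t [? ? /cong_sym st].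
- by move=> s t r [? _ st] [_ ? tr]; split=> //; apply: cong_trans st tr.
move=> s t r [/= Ss St st] Sr.
have NSM x : S x -> wordS (NS (x * r)) ~ wordS (NS x) ++ wordS (NS r).
  move=> Sx; rewrite -wordS_cat; apply: cong_wordS.
  by rewrite phiS_cat !hNS//; apply: hS.2.
split; [exact: hS.2|exact: hS.2|].
apply: (cong_trans _ (cong_catl _ (NSM s Ss))).
apply: (cong_trans _ _ (cong_sym (cong_catl _ (NSM t St)))).
by rewrite !catA; apply: cong_catr.
Qed.

Lemma derivable_theta_mull {u v} :
  U u -> U v -> derivable_theta v `<=` derivable_theta (u * v).
Proof.
move=> Uu Uv [s t] [/= Ss St st]; split=> //=.
have NUM : wordU (NU (u * v)) ~ wordU (NU u) ++ wordU (NU v).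
  rewrite -wordU_cat; apply: cong_wordU.
  by rewrite phiU_cat !hNU//; apply: hU.2.
apply: (cong_trans _ (cong_catr _ NUM)).
apply: (cong_trans _ _ (cong_sym (cong_catr _ NUM))).
by rewrite -!catA; apply: cong_catl.
Qed.

Lemma equiv_join_derivable {u} {D : set M} :
  (forall v, D v -> theta S v `<=` derivable_theta u) ->
  equiv_join S D (theta S) `<=` derivable_theta u.
Proof.
move=> Du; apply: smallest_sub; first by case: (derivable_theta_right_congruence u).
by move=> st [v /Du]; apply.
Qed.

(** Only the generating pairs [Om] need to be derivable, because the derivable
    ones form a right congruence. *)
Lemma theta_derivable_of_generators {u} {Om : set (M * M)} :
  generates_right_congruence S Om (theta S u) ->
  (forall s t, Om (s, t) ->
     wordU (NU u) ++ wordS (NS s) ~ wordU (NU u) ++ wordS (NS t)) ->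
  theta S u `<=` derivable_theta u.
Proof.
move=> [OmS <-] Omu; apply: smallest_sub.
  exact: derivable_theta_right_congruence.
by move=> [s t] st; have [? ?] := OmS _ st; split=> //; apply: Omu.
Qed.

Lemma presentation_of_derivable_theta :
  R `<=` word_kernel Phi ->
  (forall u, U u -> theta S u `<=` derivable_theta u) ->
  has_presentation (setprod U S) R Phi.
Proof.
move=> soundR thetaR.
have sound : congruence_generated R `<=` word_kernel Phi.
  by apply: smallest_sub soundR; apply/word_congruence_kernel/Phi_morphism.
split; first exact: Phi_morphism.
  apply/seteqP; split=> [_ [w _ <-]|_ [u Uu [s Ss <-]]].
    have [a [b /sound]] := cong_factor w; rewrite /word_kernel /= => ->.
    rewrite Phi_factored; exists (phiU a); first exact: phiU_in.
    by exists (phiS b) => //; apply: phiS_in.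
  by exists (wordU (NU u) ++ wordS (NS s)) => //; rewrite Phi_factored hNU ?hNS.
apply/seteqP; split=> // -[c d]; rewrite /word_kernel /= => cd.
have [a [b ab]] := cong_factor c; have [a' [b' ab']] := cong_factor d.
apply: (cong_trans _ ab); apply: (cong_trans _ _ (cong_sym ab')).
have eq_us : phiU a * phiS b = phiU a' * phiS b'.
  by rewrite -!Phi_factored; move: (sound _ ab) (sound _ ab') => /= <- <-.
(* This is (A2); from here on [w] is the common [U]-part of both words. *)
have eq_w : phiU a * act (phiS b) 1 = phiU a' * act (phiS b') 1.
  by apply: (action_pair_A2 hUS) => //;
    try apply/adjoin1_sub; apply: phiU_in || apply: phiS_in.
apply: (cong_trans _ (cong_absorb a b)).
apply: (cong_trans _ _ (cong_sym (cong_absorb a' b'))).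
set w := phiU a * act (phiS b) 1 in eq_w *; rewrite -eq_w.
have Uw : U w by apply: hU.2; [exact: phiU_in | exact/plus_in/phiS_in].
(* [w * s = u * (s^+ * s) = u * s], and likewise for the other word. *)
have [|_ _ /=] := thetaR w Uw (phiS b, phiS b').
  split=> /=; try exact: phiS_in.
  by rewrite {2}eq_w -!mulgA !plusK//; apply: phiS_in.
have NSK e : wordS e ~ wordS (NS (phiS e)).
  by apply: cong_wordS; rewrite hNS//; apply: phiS_in.
move=> st; apply: (cong_trans _ (cong_catl _ (NSK b))).
exact: (cong_trans _ st (cong_sym (cong_catl _ (NSK b')))).
Qed.

End Derivations.

End ActionPairs.

(** * The two presentations *)

Theorem theorem6p28 (M : monoidType) (U S : set M) (act : M -> M -> M)
  (hUS : action_pair U S act) (hU : submonoid U) (hS : submonoid S)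
  (Om : M -> set (M * M))
  (hOm : forall u, U u -> generates_right_congruence S (Om u) (theta S u))
  (XU XS : Type)
  (RU : set (seq XU * seq XU)) (RS : set (seq XS * seq XS))
  (phiU : seq XU -> M) (phiS : seq XS -> M)
  (hphiU : has_presentation U RU phiU) (hphiS : has_presentation S RS phiS)
  (hphiU1 : forall x : XU, phiU [:: x] <> 1)
  (hphiS1 : forall x : XS, phiS [:: x] <> 1)
  (hphiU_inj : injective (fun x : XU => phiU [:: x]))
  (hphiS_inj : injective (fun x : XS => phiS [:: x]))
  (NU : M -> seq XU) (NS : M -> seq XS)
  (hNU : normal_form_function U phiU NU) (hNS : normal_form_function S phiS NS)
  (hNU1 : NU 1 = [::]) (hNS1 : NS 1 = [::])
  (hNUx : forall x : XU, NU (phiU [:: x]) = [:: x])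
  (hNSx : forall x : XS, NS (phiS [:: x]) = [:: x]) :
  (forall V : set M, V `<=` U ->
     (forall u, U u ->
        theta S u = equiv_join S [set v | V v /\ preceq U v u] (theta S)) ->
     has_presentation (setprod U S)
       (liftU RU `|` liftS RS `|` R1 phiU phiS act NU
          `|` R2' Om NU NS V `|` R3 phiS act NU)
       (Phi phiU phiS))
  /\
  ((forall u v, U u -> U v -> u * v = v * u) ->
   (forall u v, U u -> U v ->
      theta S (u * v) = equiv_join S [set w | w = u \/ w = v] (theta S)) ->
   has_presentation (setprod U S)
     (liftU RU `|` liftS RS `|` R1 phiU phiS act NU
        `|` R2'' phiU Om NS `|` R3 phiS act NU)
     (Phi phiU phiS)).
Proof.
have OmE u s t : U u -> Om u (s, t) -> u * s = u * t.
  move=> Uu st; have [_ Omu] := hOm u Uu.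
  suff: theta S u (s, t) by case.
  by rewrite -Omu; apply: sub_gen_smallest.
have OmS u s t : U u -> Om u (s, t) -> S s /\ S t.
  by move=> Uu st; have [OmS _] := hOm u Uu; apply: OmS st.
have sound := common_relators_sound hUS hU hphiU hphiS hNU.
split=> [V VU thetaV|UC thetaM].
  set R := (X in has_presentation _ X _).
  have coreR : @common_relators M act XU XS RU RS phiU phiS NU `<=` R.
    by move=> r [] rel; [left; left | right].
  apply: (presentation_of_derivable_theta hUS hU hS hphiU hphiS hNU hNS hNU1 coreR).
    move=> r [[rcore|]|]; last by move=> r3; apply: sound; right.
      by apply: sound; left.
    move=> [v [s [t [Vv st ->]]]]; have Uv := VU v Vv.
    have [Ss St] := OmS _ _ _ Uv st.
    apply: word_kernelI; rewrite !(Phi_factored hphiU hphiS) hNU // !hNS //.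
    exact: OmE.
  move=> u Uu; rewrite {1}(thetaV u Uu).
  apply: (equiv_join_derivable hS hphiS hNS coreR) => v [Vv [w /(adjoin1_sub hU) Uw ->]].
  have Uv := VU v Vv.
  apply: (subset_trans _ (derivable_theta_mull hU hphiU hNU coreR Uw Uv)).
  apply: (theta_derivable_of_generators hS hphiS hNS coreR (hOm v Uv)) => s t st.
  by apply: cong_relator; left; right; exists v, s, t.
set R := (X in has_presentation _ X _).
have coreR : @common_relators M act XU XS RU RS phiU phiS NU `<=` R.
  by move=> r [] rel; [left; left | right].
have U_ := phiU_in hphiU.
apply: (presentation_of_derivable_theta hUS hU hS hphiU hphiS hNU hNS hNU1 coreR).
  move=> r [[rcore|]|]; last by move=> r3; apply: sound; right.
    by apply: sound; left.
  move=> [x [s [t [st ->]]]].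
  have [Ss St] := OmS _ _ _ (U_ _) st.
  apply: word_kernelI; rewrite !(Phi_factored hphiU hphiS) !hNS //.
  exact: OmE (U_ _) st.
(* The [theta] of a product is the join over its letters, so induct on a word
   for [u]; [theta S 1] is equality because [1] cancels. *)
move=> u Uu; rewrite -(hNU u Uu); elim: (NU u) => [|x a IH].
  rewrite (phiU_nil hphiU) => -[s t] [/= Ss St]; rewrite !mul1g => <-.
  by split=> //; apply: cong_refl.
rewrite -(cat1s x) (phiU_cat hphiU) {1}thetaM //.
apply: (equiv_join_derivable hS hphiS hNS coreR) => _ [->|->].
  (* Relators are available to the right of [x] only, so [x] must come last. *)
  rewrite (UC _ _ (U_ _) (U_ _)).
  apply: (subset_trans _ (derivable_theta_mull hU hphiU hNU coreR (U_ _) (U_ _))).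
  apply: (theta_derivable_of_generators hS hphiS hNS coreR (hOm _ (U_ _))) => s t st.
  by rewrite hNUx; apply: cong_relator; left; right; exists x, s, t.
exact: (subset_trans IH (derivable_theta_mull hU hphiU hNU coreR (U_ _) (U_ _))).
Qed.
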